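(* Let $0<p<1$, let $x>0$ and $0<a\le \frac12$. (a) Let $(d_n)_{n\ge1}$ be any sequence of positive real numbers such that $d_n\to+\infty$ and $d_n=o(n)$ as $n\to\infty$. Then $$\frac{n-L(\lfloor p^{-1}n-xn^a\rfloor,\,n)}{d_n}\longrightarrow 0\quad\text{in probability as } n\to\infty.$$ (b) Let $(d_n)_{n\ge1}$ be any sequence of positive real numbers such that $d_n=o(n)$ and $\frac{d_n}{\log n}\to+\infty$ as $n\to\infty$. Then $$\lim_{n\to\infty}\frac{n-L(\lfloor p^{-1}n-xn^a\rfloor,\,n)}{d_n}=0\quad\text{almost surely}.$$
   Context: Let $\{X_v\}_{v\in\mathbb{Z}^2}$ be independent Bernoulli random variables on a common probability space with $\mathbb{P}(X_v=1)=p=1-q$ and $\mathbb{P}(X_v=0)=q$. A site $v$ is called marked if $X_v=1$. For positive integers $m,n$, $L(m,n)$ denotes the maximal number of marked sites that can be collected along a path in the rectangle $\{1,\dots,m\}\times\{1,\dots,n\}$ that is strictly increasing in both coordinates; that is, $L(m,n)$ is the largest $k\ge 0$ for which there exist marked sites $(i_1,j_1),\dots,(i_k,j_k)$ with $1\le i_1<i_2<\dots<i_k\le m$ and $1\le j_1<j_2<\dots<j_k\le n$. The same field $\{X_v\}$ is used for all $(m,n)$. The quantity $L(\lfloor p^{-1}n-xn^a\rfloor,n)$ is considered for $n$ large enough that $\lfloor p^{-1}n-xn^a\rfloor\ge1$. *)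

(* Defs.v *)
From HB Require Import structures.
From mathcomp Require Import all_boot all_order all_algebra finmap.
From mathcomp Require Import all_classical all_reals all_analysis.

Set Implicit Arguments.
Unset Strict Implicit.
Unset Printing Implicit Defensive.

Import Order.TTheory GRing.Theory Num.Theory.
Import numFieldNormedType.Exports.

Local Open Scope classical_set_scope.
Local Open Scope ring_scope.

Definition mutually_independent (disp disp' : measure_display)
    (T : measurableType disp) (T' : measurableType disp') (R : realType)
    (P : probability T R) (I : choiceType) (X : I -> {RV P >-> T'}) : Prop :=
  forall (J : {fset I}) (B : I -> set T'),
    (forall i, i \in J -> measurable (B i)) ->
    P (\bigcap_(i in [set` J]) X i @^-1` B i) =
      (\prod_(i <- J) P (X i @^-1` B i))%E.

Definition bernoulli_RV (disp : measure_display) (T : measurableType disp)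
    (R : realType) (P : probability T R) (p : R) (X : {RV P >-> R}) : Prop :=
  P (X @^-1` [set 1]) = p%:E /\ P (X @^-1` [set 0]) = (1 - p)%:E.

Definition cvg_in_probability (disp : measure_display)
    (T : measurableType disp) (R : realType) (P : probability T R)
    (Y : nat -> T -> R) (Z : T -> R) : Prop :=
  forall eps : R, 0 < eps ->
    P [set w | eps < `|Y n w - Z w|] @[n --> \oo] --> 0%E.

Definition cvg_almost_surely (disp : measure_display)
    (T : measurableType disp) (R : realType) (P : probability T R)
    (Y : nat -> T -> R) (Z : T -> R) : Prop :=
  {ae P, forall w, Y n w @[n --> \oo] --> Z w}.

Definition site : Type := (int * int)%type.

Definition marked (R : realType) (xi : site -> R) (v : site) : bool :=
  xi v == 1.

Definition lt_both (u v : site) : bool := (u.1 < v.1) && (u.2 < v.2).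

Definition in_rect (m n : int) (v : site) : bool :=
  (1 <= v.1 <= m) && (1 <= v.2 <= n).

Definition collectable (R : realType) (xi : site -> R) (m n : int) (k : nat) :
    Prop :=
  exists s : seq site,
    [/\ size s = k, sorted lt_both s, all (in_rect m n) s & all (marked xi) s].

(* The largest collectable k. The range k <= `|n| loses nothing, because the
   second coordinates of a path are distinct elements of {1, ..., n}: see
   L_collectable and collectable_leq_L. If m < 1 or n < 1, then L = 0. *)
Definition L (R : realType) (xi : site -> R) (m n : int) : nat :=
  \max_(k < `|n|%N.+1 | `[< collectable xi m n k >]) k.

Lemma collectable_leq (R : realType) (xi : site -> R) (m n : int) (k : nat) :
  collectable xi m n k -> (k <= `|n|)%N.
Proof.
case=> s [<- ss sr _].
have us : uniq [seq `|v.2|%N | v <- s].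
  apply: (sorted_uniq ltn_trans ltnn).
  move: ss sr; case: s => // u s /=.
  elim: s u => //= v s IH u /andP[/andP[_ uv] sv] /and3P[ru rv rs].
  rewrite IH ?rv ?rs// andbT.
  move/andP: ru => [_ /andP[u1 _]]; rewrite -ltz_nat !gez0_abs//.
    by rewrite ltW// (lt_trans _ uv)// (lt_le_trans _ u1).
  by rewrite (le_trans _ u1).
rewrite -(size_map (fun v : site => `|v.2|%N)) -[leqRHS](size_iota 1).
apply: uniq_leq_size => // _ /mapP[v vs ->].
have /andP[_ /andP[v1 vn]] := allP sr _ vs.
have v0 : 0 <= v.2 by rewrite (le_trans _ v1).
rewrite mem_iota add1n ltnS -!lez_nat !gez0_abs ?(le_trans v0)//.
by rewrite v1.
Qed.

Lemma L_collectable (R : realType) (xi : site -> R) (m n : int) :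
  collectable xi m n (L xi m n).
Proof.
have c0 : collectable xi m n 0 by exists [::].
rewrite /L.
have h : `[< collectable xi m n (@ord0 `|n|%N) >] by apply/asboolP.
have [i /asboolP ci ->] := eq_bigmax_cond
  (fun k : 'I_(`|n|%N.+1) => k : nat)
  (ltac:(by apply/card_gt0P; exists ord0)
   : (0 < #|[pred k : 'I_(`|n|%N.+1) | `[< collectable xi m n k >]]|)%N).
exact: ci.
Qed.

Lemma collectable_leq_L (R : realType) (xi : site -> R) (m n : int) (k : nat) :
  collectable xi m n k -> (k <= L xi m n)%N.
Proof.
move=> ck; have kn : (k < `|n|%N.+1)%N by rewrite ltnS (collectable_leq ck).
by apply: (@leq_bigmax_cond _ _ _ (Ordinal kn)); apply/asboolP.
Qed.

(* Main.v *)
Require Import Defs.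
From mathcomp Require Import all_boot all_order all_algebra finmap.
From mathcomp Require Import all_classical all_reals all_analysis.
From mathcomp Require Import lra ring zify.

(** Write [loss n = n - L]. It suffices that [P (loss n > 2 B) <= C exp (- ka B)]
    uniformly in [n >= N0 B]: part (a) is then immediate and part (b) is
    Borel-Cantelli. To get this bound, cut the [n] rows into [B] blocks of
    [N = n / B] rows and allow one skipped row in each block. Inside a block let
    [u] be the column reached greedily and [v <= u] the best column reached with
    one skip. In a new row, [u] moves to the next marked column and [v] to the
    next marked column or to the old [u], whichever comes first. So [u] and [v]
    perform independent geometric walks, except that [u] pushes [v] back. This
    reflection gains order [sqrt N] columns per block over the mean [N / p],
    hence order [sqrt (n B)] in total, which exceeds [x n ^ a <= x sqrt n] for
    [B] large. The gain is expressed by an exponential supermartingale,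
      [r ^ (u + v) ((1 - be) l0 ^ k + be l1 ^ k cos (kap (u - v)))]
    with [k] rows left in the block. Here [r = exp s], [s] of order [1 / sqrt N]:
    the constant and the cosine are a super-eigenfunction each of the reflected
    pair of walks, the cosine with the smaller eigenvalue [l1]. *)

Set Implicit Arguments.
Unset Strict Implicit.
Unset Printing Implicit Defensive.

Import Order.TTheory GRing.Theory Num.Theory.
Import numFieldNormedType.Exports.

Local Open Scope classical_set_scope.
Local Open Scope ring_scope.

(** * The potential *)

Section Potential.
Context (R : realType).
Variables (p r kap be : R).
Hypothesis hp : 0 < p < 1.
Hypothesis hr : 1 <= r.
Hypothesis hqr : (1 - p) * r < 1.
Hypothesis hbe : 0 <= be <= 1.

Let q : R := 1 - p.
Let ck (D : nat) : R := cos (kap * D%:R).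

(** The squared modulus of [1 - (1 - p) r exp (i kap)], the denominator of the generating function
    of a geometric jump at [r exp (i kap)]. *)
Definition potQ : R := 1 - 2 * (1 - p) * r * cos kap + ((1 - p) * r) ^+ 2.
Definition pot0 : R := p * r / (1 - (1 - p) * r).
Definition pot1 : R := (p * r) ^+ 2 / potQ.

(* [v <= u] and [k] counts the rows left in the block. For
   [m z = p z / (1 - (1 - p) z)], the generating function of a geometric jump,
   the growth factors are [pot0 ^ 2 = (m r) ^ 2] and
   [pot1 = |m (r exp (i kap))| ^ 2]. *)
Definition potential (k v u : nat) : R :=
  r ^+ (u + v) * ((1 - be) * (pot0 ^+ 2) ^+ k + be * pot1 ^+ k * cos (kap * (u - v)%:R)).

(* The mean of [potential k v u'] over the geometric jump from [u] to [u']. *)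
Definition half_potential (k v u : nat) : R :=
  r ^+ (u + v) * ((1 - be) * (pot0 ^+ 2) ^+ k * pot0 +
    be * pot1 ^+ k * (p * r / potQ) *
      (cos (kap * (u - v).+1%:R) - (1 - p) * r * cos (kap * (u - v)%:R))).

Let q0 : 0 < q. Proof. by case/andP: hp => *; rewrite /q; lra. Qed.
Let p0 : 0 < p. Proof. by case/andP: hp. Qed.
Let r0 : 0 < r. Proof. by apply: lt_le_trans hr. Qed.

(** The reverse triangle inequality [|1 - z| >= 1 - |z|], squared; it keeps [potQ] away from
    zero. *)
Lemma potQ_ge : (1 - (1 - p) * r) ^+ 2 <= potQ.
Proof.
rewrite -subr_ge0.
have -> : potQ - (1 - (1 - p) * r) ^+ 2 = 2 * (q * r) * (1 - cos kap).
  by rewrite /potQ /q; ring.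
by rewrite mulr_ge0// ?subr_ge0 ?cos_le1// !mulr_ge0// ltW.
Qed.

Lemma potQ_gt0 : 0 < potQ.
Proof. by apply: lt_le_trans potQ_ge; rewrite exprn_gt0// subr_gt0. Qed.

Lemma pot0_ge1 : 1 <= pot0.
Proof.
rewrite /pot0 ler_pdivlMr ?subr_gt0// mul1r.
have : 0 <= r - 1 by rewrite subr_ge0.
lra.
Qed.

Lemma pot1_ge0 : 0 <= pot1.
Proof. by rewrite divr_ge0// ?sqr_ge0// ltW// potQ_gt0. Qed.

Lemma cos_rec D : ck D.+2 = 2 * cos kap * ck D.+1 - ck D.
Proof.
rewrite /ck.
have -> : kap * D.+2%:R = kap * D.+1%:R + kap by rewrite -(natr1 D.+1); ring.
have -> : kap * D%:R = kap * D.+1%:R - kap by rewrite -(natr1 D); ring.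
by rewrite cosD cosB; ring.
Qed.

(** The next block starts both walks from [v], so the value at the end of a block must dominate
    [r ^ (2 v)]. Divided by [r ^ (u + v)], the claim is the hypothesis at [D = u - v]. *)
Lemma potential_end v u : (v <= u)%N ->
  (forall D : nat, r ^- D <= 1 - be + be * cos (kap * D%:R)) ->
  potential 0 v v <= potential 0 v u.
Proof.
move=> vu h; rewrite /potential !expr0 subnn mulr0 cos0 !mulr1 subrK mulr1.
have -> : (u + v = (v + v) + (u - v))%N by lia.
rewrite [r ^+ (v + v + _)]exprD -mulrA; apply: ler_peMr; first by rewrite exprn_ge0 ?ltW.
by rewrite mulrC -ler_pdivrMr ?exprn_gt0// mul1r.
Qed.

Lemma half_potential_rec k v u : (v <= u)%N ->
  half_potential k v u = p * potential k v u.+1 + (1 - p) * half_potential k v u.+1.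
Proof.
move=> vu; rewrite /half_potential /potential subSn//.
move: (u - v)%N => D; rewrite addSn [r ^+ _.+1]exprS.
have := cos_rec D; rewrite /ck => ->.
have hD : 1 - (1 - p) * r != 0 by rewrite gt_eqF// subr_gt0.
have h1 : pot0 - (p * r + (1 - p) * r * pot0) = 0 by rewrite /pot0; field.
have hQ : potQ != 0 by rewrite gt_eqF// potQ_gt0.
(* An opaque [x] keeps the closing [ring] polynomial. [h1] and [h2] are the coefficients of the
   constant and of the cosine part. *)
have [x hx] : {x | x = p * r / potQ} by eexists.
have h2 : x - (x * (2 * (1 - p) * r * cos kap - ((1 - p) * r) ^+ 2) + p * r) = 0.
  have e : x * potQ = p * r by rewrite hx divfK.
  by rewrite -e /potQ; ring.
rewrite -hx; apply/eqP; rewrite -subr_eq0; apply/eqP.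
rewrite [LHS](_ : _ = r ^+ (u + v) * ((1 - be) * (pot0 ^+ 2) ^+ k *
   (pot0 - (p * r + (1 - p) * r * pot0)) + be * pot1 ^+ k * cos (kap * D.+1%:R) *
   (x - (x * (2 * (1 - p) * r * cos kap - ((1 - p) * r) ^+ 2) + p * r)))).
  by rewrite h1 h2 !mulr0 addr0 mulr0.
ring.
Qed.

(** Permits a scan over infinitely many columns: the cosines are bounded, so the decay is of order
    [((1 - p) r) ^ j]. *)
Lemma half_potential_cvg k v u : (v <= u)%N ->
  (1 - p) ^+ j * half_potential k v (u + j)%N @[j --> \oo] --> 0.
Proof.
move=> vu.
pose C : R := r ^+ (u + v) * (`|(1 - be) * (pot0 ^+ 2) ^+ k * pot0| +
  `|be * pot1 ^+ k * (p * r / potQ)| * (1 + q * r)).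
have hC : C * (q * r) ^+ j @[j --> \oo] --> 0.
  rewrite -[0](mulr0 C); apply: cvgMr; apply: cvg_expr.
  by rewrite ger0_norm// mulr_ge0// ltW.
apply: (@squeeze_cvgr _ _ _ _ (fun j => - (C * (q * r) ^+ j))
  (fun j => C * (q * r) ^+ j)) => //; last first.
  by rewrite -[0]oppr0; apply: cvgN.
apply: nearW => j; rewrite -ler_norml.
rewrite /half_potential !normrM (_ : (u + j + v = u + v + j)%N); last by lia.
rewrite exprD (ger0_norm (exprn_ge0 j (ltW q0))).
rewrite normrM !(ger0_norm (exprn_ge0 _ (ltW r0))) [(q * r) ^+ j]exprMn.
rewrite [leLHS](_ : _ = r ^+ (u + v) * `|(1 - be) * (pot0 ^+ 2) ^+ k * pot0 +
    be * pot1 ^+ k * (p * r / potQ) *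
      (cos (kap * (u + j - v).+1%:R) - (1 - p) * r * cos (kap * (u + j - v)%:R))| *
    (q ^+ j * r ^+ j)); last by rewrite /q; ring.
rewrite ler_wpM2r ?mulr_ge0 ?exprn_ge0 ?(ltW q0) ?(ltW r0)//.
rewrite /C ler_wpM2l ?exprn_ge0 ?(ltW r0)//.
apply: le_trans (ler_normD _ _) _; rewrite lerD2l normrM ler_wpM2l//.
apply: le_trans (ler_normB _ _) _; apply: lerD; first exact: cos_max.
rewrite normrM ger0_norm; last by rewrite mulr_ge0// ltW.
by rewrite ler_piMr ?cos_max// mulr_ge0// ltW.
Qed.

(** The reflection: [v] has reached [u] and stays there by skipping the row. Within a row only this
    comparison is lossy; its slack is [1 <= pot0] for the constant part and [cos kap <= 1 <= r] for
    the cosine part. *)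
Lemma half_potential_diag k u : half_potential k u u <= potential k.+1 u u.
Proof.
rewrite /half_potential /potential subnn mulr0 cos0 !mulr1 ler_wpM2l ?exprn_ge0 ?(ltW r0)//.
apply: lerD.
- rewrite [_ ^+ k.+1]exprS.
  rewrite [leRHS](_ : _ = (1 - be) * (pot0 ^+ 2) ^+ k * pot0 * pot0); last by ring.
  have := pot0_ge1 => h; case/andP: hbe => b0 b1.
  have e : 0 <= (pot0 ^+ 2) ^+ k by rewrite exprn_ge0// sqr_ge0.
  rewrite ler_peMr//; apply: mulr_ge0; last by lra.
  by apply: mulr_ge0 => //; lra.
- rewrite [_ ^+ k.+1]exprS [leRHS](_ : _ = be * pot1 ^+ k * pot1); last by ring.
  rewrite -mulrA ler_wpM2l//.
    by rewrite mulr_ge0 ?exprn_ge0 ?pot1_ge0//; case/andP: hbe.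
  have -> : pot1 = p * r / potQ * (p * r) by rewrite /pot1; ring.
  apply: ler_wpM2l.
    by rewrite divr_ge0 ?mulr_ge0// ltW// potQ_gt0.
  have := cos_le1 kap => h; have := hr => h'; lra.
Qed.

(** Away from the diagonal [v] tests one column freely and equality holds: [pot0] solves [h1], and
    the two terms in [cos (kap D)] cancel. *)
Lemma potential_step k v u : (v < u)%N ->
  p * half_potential k v.+1 u + (1 - p) * potential k.+1 v.+1 u <= potential k.+1 v u.
Proof.
move=> vu; rewrite le_eqVlt; apply/orP; left; apply/eqP.
rewrite /half_potential /potential.
have -> : (u - v = (u - v.+1).+1)%N by lia.
move: (u - v.+1)%N => D; rewrite addnS [r ^+ _.+1]exprS.
have h1 : p * r * pot0 + (1 - p) * r * pot0 ^+ 2 = pot0 ^+ 2.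
  by rewrite /pot0; field; rewrite gt_eqF// subr_gt0.
have -> : pot1 = p * r / potQ * (p * r) by rewrite /pot1; ring.
rewrite !(exprS _ k) [LHS](_ : _ = r ^+ (u + v) * ((1 - be) * (pot0 ^+ 2) ^+ k *
   (p * r * pot0 + (1 - p) * r * pot0 ^+ 2) +
   be * (p * r / potQ * (p * r)) ^+ k * (p * r / potQ * (p * r)) * cos (kap * D.+1%:R))).
  by rewrite h1; ring.
ring.
Qed.

End Potential.

(** * Choice of the parameters *)

Section Estimates.
Context (R : realType).
Implicit Types (p s x y t : R).

Lemma sin_mulrn_le y (D : nat) : `|sin (D%:R * y)| <= D%:R * `|sin y|.
Proof.
elim: D => [|D IH]; first by rewrite !mul0r sin0 normr0.
rewrite -natr1 !mulrDl !mul1r sinD.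
apply: le_trans (ler_normD _ _) _; rewrite !normrM; apply: lerD.
  by apply: le_trans IH; rewrite ler_piMr// cos_max.
by rewrite ler_piMl// cos_max.
Qed.

Lemma one_sub_cos x : 1 - cos x = 2 * sin (x / 2) ^+ 2.
Proof.
rewrite {1}[x]splitr cosD -!expr2.
have := cos2Dsin2 (x / 2); lra.
Qed.

(** Lets [kap] enter the estimates through [1 - cos kap] alone, with no expansion of [acos]. *)
Lemma one_sub_cos_mulrn x (D : nat) :
  1 - cos (x * D%:R) <= D%:R ^+ 2 * (1 - cos x).
Proof.
rewrite !one_sub_cos [leRHS]mulrCA ler_pM2l// -exprMn -[leLHS]real_normK ?num_real//.
rewrite -[leRHS]real_normK ?num_real// ler_sqr ?nnegrE//.
rewrite normrM (ger0_norm (ler0n _ D)) [x * _]mulrC -mulrA.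
exact: sin_mulrn_le.
Qed.

Lemma expR_inv_le x : 0 <= x -> expR (- x) <= (1 + x)^-1.
Proof.
move=> x0; have h : 0 < 1 + x by lra.
by rewrite expRN lef_pV2 ?posrE ?expR_gt0 ?expR_ge1Dx.
Qed.

Lemma expR_quad_le s : 0 <= s <= 1 / 2 -> expR s <= 1 + s + 2 * s ^+ 2.
Proof.
case/andP=> s0 s1; have h := expR_ge1Dx (- s).
have e := expRxMexpNx_1 s; have e0 := expR_gt0 s.
have h1 : expR s * (1 - s) <= 1 by rewrite -[X in _ <= X]e ler_wpM2l// ltW.
have h2 : 0 < 1 - s by lra.
rewrite -(ler_pM2r h2); apply: le_trans h1 _.
rewrite -subr_ge0 (_ : _ - 1 = s ^+ 2 * (1 - 2 * s)); last by ring.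
by rewrite mulr_ge0 ?sqr_ge0//; lra.
Qed.

Lemma expRN_quad_le y : 0 <= y <= 1 / 2 -> expR (- (y + 2 * y ^+ 2)) <= 1 - y.
Proof.
case/andP=> y0 y1; have yy : 0 <= y ^+ 2 by rewrite sqr_ge0.
apply: le_trans (expR_inv_le _) _; first lra.
rewrite -div1r ler_pdivrMr; last by lra.
rewrite -subr_ge0 (_ : _ - 1 = y ^+ 2 * (1 - 2 * y)); last by ring.
by rewrite mulr_ge0//; lra.
Qed.

(** With [t = s D], the left side is at most [1 - t / (1 + t)]. The defect [w] of the cosine is at
    most [2] and at most [(C t) ^ 2 / 2], hence at most their geometric mean [C t]. The bound [C t]
    serves for [t <= 1], the bound [2] for [t > 1]. *)
Lemma terminal_le s C kap (D : nat) : 0 <= s -> 2 <= C ->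
  1 - cos kap = (C * s) ^+ 2 / 2 ->
  (expR s) ^- D <= 1 - (2 * C)^-1 + (2 * C)^-1 * cos (kap * D%:R).
Proof.
move=> s0 C2 hk.
pose w := 1 - cos (kap * D%:R).
pose t := s * D%:R.
have t0 : 0 <= t by rewrite mulr_ge0.
have w2 : w <= 2 by rewrite /w; have := cos_geN1 (kap * D%:R); lra.
have w0 : 0 <= w by rewrite /w; have := cos_le1 (kap * D%:R); lra.
have wt : w <= (C * t) ^+ 2 / 2.
  apply: le_trans (one_sub_cos_mulrn _ _) _.
  by rewrite hk /t le_eqVlt; apply/orP; left; apply/eqP; field.
have C0 : 0 < C by lra.
have wCt : w <= C * t.
  rewrite -ler_sqr ?nnegrE// ?mulr_ge0 ?(ltW C0)//.
  by rewrite expr2 (le_trans (ler_pM w0 w0 w2 wt))//; lra.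
rewrite -expRM_natr -expRN.
apply: le_trans (expR_inv_le t0) _.
have -> : 1 - (2 * C)^-1 + (2 * C)^-1 * cos (kap * D%:R) = 1 - w / (2 * C).
  by rewrite /w; field; rewrite gt_eqF.
have h : w / (2 * C) <= t / (1 + t).
  rewrite ler_pdivrMr; last by lra.
  rewrite mulrAC ler_pdivlMr; last by lra.
  have [t1|t1] := lerP t 1.
    have : w * (1 + t) <= C * t * 2 by apply: ler_pM => //; lra.
    lra.
  have : w * (1 + t) <= 2 * (2 * t) by apply: ler_pM => //; lra.
  have : 2 * t <= C * t by rewrite ler_wpM2r.
  lra.
have -> : (1 + t)^-1 = 1 - t / (1 + t) by field; rewrite gt_eqF//; lra.
lra.
Qed.

(** Second order expansion of [ln (pot0 (exp s))], whose slope [1 / p] is the mean of a geometric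
    jump. The denominator is at least [p (1 - y)], where [y] collects the expansion of [exp s]. *)
Lemma pot0_le p s : 0 < p < 1 -> 0 <= s -> s <= 1 / 2 -> 2 * ((1 - p) / p) * s <= 1 / 2 ->
  (1 - p) * expR s < 1 /\
  pot0 p (expR s) <= expR (s / p + (2 * ((1 - p) / p) + 8 * ((1 - p) / p) ^+ 2) * s ^+ 2).
Proof.
move=> /andP[p0 p1] s0 s1 s2.
set o := (1 - p) / p in s2 *.
have o0 : 0 <= o by rewrite divr_ge0 ?(ltW p0)//; lra.
have op : o * p = 1 - p by rewrite /o divfK// gt_eqF.
pose y := o * (s + 2 * s ^+ 2).
have ss : 2 * s ^+ 2 <= s.
  by rewrite expr2 mulrA ler_piMl//; lra.
have ss0 : 0 <= s ^+ 2 by rewrite sqr_ge0.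
have y0 : 0 <= y by rewrite mulr_ge0// addr_ge0// mulr_ge0.
have y2 : y <= 2 * o * s.
  rewrite /y (_ : 2 * o * s = o * (2 * s)); last by ring.
  by rewrite ler_wpM2l//; lra.
have ey : expR (- (y + 2 * y ^+ 2)) <= 1 - y by apply: expRN_quad_le; rewrite y0 /=; lra.
have es : expR s <= 1 + s + 2 * s ^+ 2 by apply: expR_quad_le; rewrite s0.
have h1 : p * (1 - y) <= 1 - (1 - p) * expR s.
  have : (1 - p) * expR s <= (1 - p) * (1 + s + 2 * s ^+ 2) by rewrite ler_wpM2l//; lra.
  have -> : p * (1 - y) = p - (o * p) * (s + 2 * s ^+ 2) by rewrite /y; ring.
  by rewrite op; lra.
have d0 : 0 < 1 - (1 - p) * expR s.
  by apply: lt_le_trans h1; rewrite mulr_gt0//; lra.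
split; first lra.
rewrite /pot0 ler_pdivrMr//.
set A := 2 * o + _.
have yA : y + 2 * y ^+ 2 <= o * s + A * s ^+ 2.
  have : y ^+ 2 <= (2 * o * s) ^+ 2 by rewrite ler_sqr ?nnegrE// mulr_ge0// mulr_ge0.
  rewrite /y /A; lra.
have -> : p * expR s = expR (s / p + A * s ^+ 2) * (p * expR (- (o * s + A * s ^+ 2))).
  rewrite mulrCA -expRD; congr (_ * expR _).
  by rewrite /o; field; rewrite gt_eqF.
rewrite ler_wpM2l ?expR_ge0//; apply: le_trans h1.
rewrite ler_wpM2l ?(ltW p0)//; apply: le_trans ey.
by rewrite ler_expR lerN2.
Qed.

(** [potQ] exceeds [(1 - (1 - p) r) ^ 2] by [(1 - p) r dd]. As that square is at most [1] and
    [r >= 1], this is a relative gain of at least [(1 - p) dd]. *)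
Lemma pot1_le p r kap (dd : R) : 0 < p < 1 -> 1 <= r -> (1 - p) * r < 1 ->
  0 <= dd -> 1 - cos kap = dd / 2 ->
  pot1 p r kap <= pot0 p r ^+ 2 / (1 + (1 - p) * dd).
Proof.
move=> /andP[p0 p1] r1 qr d0 hk.
have q0 : 0 < 1 - p by lra.
have qr0 : 0 < (1 - p) * r by rewrite mulr_gt0//; lra.
have qd0 : 0 <= (1 - p) * dd by rewrite mulr_ge0// ltW.
have z0 : 0 < (1 - (1 - p) * r) ^+ 2 by rewrite exprn_gt0//; lra.
have z1 : (1 - (1 - p) * r) ^+ 2 <= 1 by rewrite expr_le1//; lra.
rewrite /pot1 /pot0 expr_div_n -[leRHS]mulrA -invfM ler_wpM2l ?sqr_ge0//.
rewrite lef_pV2 ?posrE; last 2 first.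
- by apply: potQ_gt0 => //; rewrite p0.
- by rewrite mulr_gt0//; lra.
have -> : potQ p r kap = (1 - (1 - p) * r) ^+ 2 + (1 - p) * r * dd.
  rewrite /potQ; have -> : cos kap = 1 - dd / 2 by lra.
  by field.
rewrite mulrDr mulr1 lerD2l.
apply: (@le_trans _ _ ((1 - p) * dd)); first by rewrite ler_piMl.
by rewrite mulrAC ler_peMr.
Qed.

Lemma bernoulli_ineq x (N : nat) : 0 <= x -> 1 + N%:R * x <= (1 + x) ^+ N.
Proof.
move=> x0; elim: N => [|N IH]; first by rewrite mul0r addr0.
rewrite exprS; apply: le_trans (ler_wpM2l _ IH); last by lra.
have : 0 <= N%:R * x * x by rewrite !mulr_ge0.
rewrite -natr1; lra.
Qed.

(* Writing [o = (1 - p) / p], [A = 2 o + 8 o ^ 2] bounds the second order term of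
   [ln (pot0 (exp s))]; [be = 1 / (2 C)] makes the terminal condition hold for
   [1 - cos kap = (C s) ^ 2 / 2], and [C] is large enough for the decay of the
   cosine term to beat the growth [exp (2 A tau)] of the constant one. *)
Lemma potential_params p : 0 < p < 1 ->
  exists tau ka s0 : R, [/\ 0 < tau, 0 < ka, 0 < s0 &
    forall (N : nat) s, (0 < N)%N -> 0 <= s <= s0 -> N%:R * s ^+ 2 = tau ->
    exists kap be : R, [/\ 0 <= be <= 1, (1 - p) * expR s < 1,
      (forall D : nat, (expR s) ^- D <= 1 - be + be * cos (kap * D%:R)) &
      (1 - be) * (pot0 p (expR s) ^+ 2) ^+ N + be * pot1 p (expR s) kap ^+ N
        <= expR (2 * s * N%:R / p - ka)]].
Proof.
move=> hp; case/andP: (hp) => p0 p1.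
have q0 : 0 < 1 - p by lra.
pose o := (1 - p) / p.
have o0 : 0 < o by rewrite divr_gt0.
pose A := 2 * o + 8 * o ^+ 2.
have A0 : 0 < A by rewrite /A addr_gt0// mulr_gt0// exprn_gt0.
pose C := 16 * A / (1 - p).
have C2 : 2 <= C.
  rewrite /C ler_pdivlMr// /A.
  have : 1 - p <= o by rewrite /o ler_peMr ?(ltW q0)// invf_ge1 ?(ltW p1).
  have : 0 <= o ^+ 2 by rewrite sqr_ge0.
  lra.
have C0 : 0 < C by lra.
pose be := (2 * C)^-1.
have be0 : 0 < be by rewrite invr_gt0 mulr_gt0.
have be1 : be <= 1 by rewrite invf_le1; lra.
(* [tau] gives [2 A N s ^ 2 = be / 4] and [(1 - p) C ^ 2 N s ^ 2 = 1]. The block factor is then at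
   most [exp (be / 4) (1 - be / 2)] times the drift, which leaves [ka = be / 4]. The third value
   ensures [s1], [s2] and [s3]. *)
exists (be / (8 * A)), (be / 4), (2 + 4 * o + C)^-1.
have den : 0 < 2 + 4 * o + C by rewrite !addr_gt0// mulr_gt0.
split; [by rewrite divr_gt0// mulr_gt0|by rewrite divr_gt0|by rewrite invr_gt0|].
move=> N s N0 /andP[s0 ss] hN.
have sden : s * (2 + 4 * o + C) <= 1 by rewrite -ler_pdivlMr// div1r.
have so : 0 <= s * o by rewrite mulr_ge0// ltW.
have sC : 0 <= s * C by rewrite mulr_ge0// ltW.
have [s1 s2 s3] : [/\ s <= 1 / 2, 2 * o * s <= 1 / 2 & C * s <= 1] by split; lra.
have [qr hpot0] := pot0_le hp s0 s1 s2.
have Cs0 : 0 <= (C * s) ^+ 2 by rewrite sqr_ge0.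
have Cs1 : (C * s) ^+ 2 <= 1 by rewrite expr_le1//; lra.
have hk : cos (acos (1 - (C * s) ^+ 2 / 2)) = 1 - (C * s) ^+ 2 / 2.
  by rewrite acosK// in_itv /=; apply/andP; split; lra.
exists (acos (1 - (C * s) ^+ 2 / 2)), be; set kap := acos _ in hk *.
have hk' : 1 - cos kap = (C * s) ^+ 2 / 2 by lra.
have r1 : 1 <= expR s by rewrite -expR0 ler_expR.
split => //.
- by rewrite (ltW be0).
- by move=> D; apply: terminal_le.
have h1 := pot1_le hp r1 qr Cs0 hk'.
set a := pot0 p (expR s) in hpot0 h1 *.
set b := pot1 _ _ _ in h1 *.
have b0 : 0 <= b by apply: pot1_ge0.
have a1 : 1 <= a by apply: pot0_ge1.
have qd : 0 <= (1 - p) * (C * s) ^+ 2 by rewrite mulr_ge0// ltW.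
(* Over [N] rows the relative decay adds up to [1], so Bernoulli's inequality yields a factor
   [1 / 2]. *)
have hb : b ^+ N <= (a ^+ 2) ^+ N / 2.
  apply: (@le_trans _ _ ((a ^+ 2 / (1 + (1 - p) * (C * s) ^+ 2)) ^+ N)).
    by rewrite lerXn2r ?nnegrE// divr_ge0 ?sqr_ge0//; lra.
  rewrite expr_div_n; apply: ler_wpM2l; first by rewrite exprn_ge0// sqr_ge0.
  have pos : 0 < 1 + (1 - p) * (C * s) ^+ 2 by lra.
  rewrite lef_pV2 ?posrE ?exprn_gt0//.
  apply: le_trans (bernoulli_ineq _ qd).
  have -> : N%:R * ((1 - p) * (C * s) ^+ 2) = (1 - p) * C ^+ 2 * (N%:R * s ^+ 2) by ring.
  rewrite hN; have -> : (1 - p) * C ^+ 2 * (be / (8 * A)) = 1; last by lra.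
  by rewrite /be /C; field; rewrite !gt_eqF.
have ha : (a ^+ 2) ^+ N <= expR (2 * s * N%:R / p + be / 4).
  have -> : 2 * s * N%:R / p + be / 4 = (s / p + A * s ^+ 2) * (2 * N)%:R.
    have -> : be / 4 = 2 * A * (N%:R * s ^+ 2) by rewrite hN; field; rewrite !gt_eqF.
    by rewrite natrM; ring.
  rewrite expRM_natr exprM; apply: lerXn2r; rewrite ?nnegrE ?sqr_ge0//.
  by apply: lerXn2r; rewrite ?nnegrE ?expR_ge0//; lra.
have a0 : 0 <= (a ^+ 2) ^+ N by rewrite exprn_ge0// sqr_ge0.
have hbe : 1 - be / 2 <= expR (- (be / 2)) by apply: le_trans (expR_ge1Dx _); lra.
have -> : 2 * s * N%:R / p - be / 4 = 2 * s * N%:R / p + be / 4 + (- (be / 2)) by lra.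
rewrite expRD; apply: le_trans (ler_pM a0 _ ha hbe); last by lra.
have : be * b ^+ N <= be * ((a ^+ 2) ^+ N / 2) by rewrite ler_wpM2l// ltW.
lra.
Qed.
End Estimates.

(** * Exploration of the marks *)

Section Exploration.
Context (R : realType) (disp : measure_display) (T : measurableType disp).
Context (P : probability T R) (p : R) (X : site -> {RV P >-> R}).
Hypothesis hp : 0 < p < 1.
Hypothesis Xbernoulli : forall v, bernoulli_RV p (X v).
Hypothesis Xindep : mutually_independent X.

Let Pr (A : set T) : R := fine (P A).

Definition mark (v : site) : set T := X v @^-1` [set 1].

Lemma measurable_preX v (B : set R) : measurable B -> measurable (X v @^-1` B).
Proof. by move=> mB; rewrite -[X in measurable X]setTI; apply: measurable_funP. Qed.

Lemma measurable_mark v : measurable (mark v).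
Proof. exact: measurable_preX. Qed.

(** Takes the place of a filtration: [C] records the marks seen so far, and only cylinders over the
    unexplored sites [F] are tested against it. *)
Definition indep_of (F : set site) (C : set T) : Prop :=
  measurable C /\
  forall (K : {fset site}) (B : site -> set R),
    [set` K] `<=` F -> (forall i, measurable (B i)) ->
    P (C `&` \bigcap_(i in [set` K]) X i @^-1` B i) =
    (P C * \prod_(i <- K) P (X i @^-1` B i))%E.

(* [E] has probability at most [phi] given any event that is independent of the
   sites in [F]; the sites not yet explored play the role of [F]. *)
Definition cond_le (F : set site) (E : set T) (phi : R) : Prop :=
  forall C, indep_of F C -> Pr (C `&` E) <= Pr C * phi.

Let Pr_ge0 A : 0 <= Pr A.
Proof. by rewrite fine_ge0. Qed.

Let Pr_le A B : measurable A -> measurable B -> A `<=` B -> Pr A <= Pr B.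
Proof.
move=> mA mB AB; rewrite fine_le ?fin_num_measure//.
by apply: le_measure => //; rewrite inE.
Qed.

Lemma indep_of_setT F : indep_of F setT.
Proof.
split=> // K B _ mB; rewrite setTI probability_setT mul1e.
by apply: Xindep => i _; exact: mB.
Qed.

Lemma indep_of_sub F F' C : F' `<=` F -> indep_of F C -> indep_of F' C.
Proof.
move=> FF [mC h]; split=> // K B KF mB; apply: h => //.
exact: subset_trans KF FF.
Qed.

(** Revealing the site [v]: a cylinder over [K] is enlarged by the condition [B] at [v], and the
    independence of [C] is used with and without [K]. *)
Lemma indep_of_setI F C v (B : set R) : F v -> measurable B -> indep_of F C ->
  P (C `&` X v @^-1` B) = (P C * P (X v @^-1` B))%E /\
  indep_of (F `\ v) (C `&` X v @^-1` B).
Proof.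
move=> Fv mB [mC hC].
have e1 : P (C `&` X v @^-1` B) = (P C * P (X v @^-1` B))%E.
  have := hC [fset v]%fset (fun=> B).
  rewrite big_seq_fset1 set_fset1 bigcap_set1; apply => // i.
  by rewrite /= => ->.
split => //; split.
  by apply: measurableI => //; exact: measurable_preX.
move=> K B' KF mB'.
have vK : v \notin K by apply/negP => /KF [_]; apply.
pose B1 i := if i == v then B else B' i.
have := hC (v |` K)%fset B1; rewrite big_fsetU1//=.
have -> : (\prod_(i <- K) P (X i @^-1` B1 i) = \prod_(i <- K) P (X i @^-1` B' i))%E.
  rewrite !big_seq; apply: eq_bigr => i iK; rewrite /B1.
  by case: eqP => // iv; rewrite iv (negPf vK) in iK.
rewrite e1 -muleA /B1 eqxx => <-; last 2 first.
- by move=> i /=; rewrite in_fset1U => /orP[/eqP->//|/KF []].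
- by move=> i; case: ifP.
congr (P _); rewrite -setIA; congr (_ `&` _).
rewrite eqEsubset; split=> w /=.
- case=> Bv h i /=; rewrite in_fset1U; case: (eqVneq i v) => [->//|_ /=].
  exact: h.
- move=> h; split; first by have := h v; rewrite eqxx /= in_fset1U eqxx; apply.
  move=> i iK; have := h i; rewrite /= in_fset1U iK orbT; case: eqP; last by move=> _; apply.
  by move=> iv; rewrite -iv iK in vK.
Qed.

Lemma cond_le_weaken F F' E E' phi phi' : measurable E -> measurable E' ->
  F `<=` F' -> E' `<=` E -> phi <= phi' -> cond_le F E phi -> cond_le F' E' phi'.
Proof.
move=> mE mE' FF EE hphi h C hC; have [mC _] := hC.
apply: (@le_trans _ _ (Pr (C `&` E))).
  by apply: Pr_le; [exact: measurableI|exact: measurableI|exact: setIS].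
apply: le_trans (h C (indep_of_sub FF hC)) _.
by rewrite ler_wpM2l.
Qed.

Lemma cond_le_one F E : measurable E -> cond_le F E 1.
Proof.
move=> mE C [mC _]; rewrite mulr1; apply: Pr_le => //; exact: measurableI.
Qed.

(** Total probability over the mark at [v]; by [indep_of_setI] both branches remain independent of
    the other sites of [F]. *)
Lemma cond_le_query F E E1 E0 phi1 phi0 v :
  measurable E -> measurable E1 -> measurable E0 -> F v ->
  E `&` mark v `<=` E1 -> E `&` ~` mark v `<=` E0 ->
  cond_le (F `\ v) E1 phi1 -> cond_le (F `\ v) E0 phi0 ->
  cond_le F E (p * phi1 + (1 - p) * phi0).
Proof.
move=> mE mE1 mE0 Fv EE1 EE0 h1 h0 C hC; have [mC _] := hC.
have mm := measurable_mark v.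
have m1 : measurable [set 1 : R] by [].
have mc1 : measurable (~` [set 1] : set R) by exact: measurableC.
have [e1 i1] := indep_of_setI Fv m1 hC.
have [e0 i0] := indep_of_setI Fv mc1 hC.
have p1 : Pr (C `&` mark v) = Pr C * p.
  by rewrite /Pr e1 (Xbernoulli v).1 fineM ?fin_num_measure.
have p0 : Pr (C `&` ~` mark v) = Pr C * (1 - p).
  rewrite /Pr; have -> : C `&` ~` mark v = C `&` X v @^-1` (~` [set 1]) by [].
  rewrite e0 fineM ?fin_num_measure//; try exact: measurable_preX.
  by rewrite -preimage_setC probability_setC// [P (X v @^-1` _)](Xbernoulli v).1.
have -> : Pr (C `&` E) = Pr ((C `&` mark v) `&` E) + Pr ((C `&` ~` mark v) `&` E).
  rewrite /Pr -fineD ?fin_num_measure//; last 2 first.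
  - by apply: measurableI => //; exact: measurableI.
  - by apply: measurableI => //; apply: measurableI => //; exact: measurableC.
  congr fine; rewrite -measureU//; last 3 first.
  - by apply: measurableI => //; exact: measurableI.
  - by apply: measurableI => //; apply: measurableI => //; exact: measurableC.
  - by rewrite -subset0 => w [[[_ a] _] [[_ b] _]].
  by congr (P _); rewrite -setIUl -setIUr setUv setIT.
have -> : Pr C * (p * phi1 + (1 - p) * phi0) =
  Pr (C `&` mark v) * phi1 + Pr (C `&` ~` mark v) * phi0 by rewrite p1 p0; ring.
apply: lerD.
- apply: le_trans (h1 _ i1); apply: Pr_le.
  + by apply: measurableI => //; exact: measurableI.
  + by apply: measurableI => //; exact: measurableI.
  + by move=> w [[a b] c]; split => //; apply: EE1.
- apply: le_trans (h0 _ i0); apply: Pr_le.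
  + by apply: measurableI => //; apply: measurableI => //; exact: measurableC.
  + by apply: measurableI => //; apply: measurableI => //; exact: measurableC.
  + by move=> w [[a b] c]; split => //; apply: EE0.
Qed.

(** * Row by row exploration *)

Definition sitenn (c i : nat) : site := (c%:Z, i%:Z).

(** The unexplored sites when row [i] has been scanned up to column [c]. *)
Definition after (c i : nat) : set site :=
  [set v | exists c' i', v = sitenn c' i' /\
    ((i < i')%N \/ (i' = i /\ (c < c')%N))].

Definition above (i : nat) : set site :=
  [set v | exists c' i', v = sitenn c' i' /\ (i < i')%N].

Lemma above_after c i : above i `<=` after c i.
Proof. by move=> _ [c' [i' [-> h]]]; exists c', i'; split => //; left. Qed.

Lemma after_above c i : after c i.+1 `<=` above i.
Proof.
move=> _ [c' [i' [-> h]]]; exists c', i'; split => //.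
case: h => [|[-> _]]; lia.
Qed.

Lemma after_le c c' i : (c <= c')%N -> after c' i `<=` after c i.
Proof.
move=> cc _ [d [i' [-> h]]]; exists d, i'; split => //.
by case: h => [|[-> h]]; [left|right; split => //; lia].
Qed.

Lemma after_next c i : after c.+1 i `<=` after c i `\ sitenn c.+1 i.
Proof.
move=> v hv; split; first exact: after_le hv.
move: hv => [d [i' [-> h]]]; rewrite /sitenn => -[]; lia.
Qed.

(* [f c] bounds what follows if [c] is the first marked column after [u], so that
   [B u] is the geometric mean [\sum_k p (1 - p) ^ k f (u + k + 1)]. *)
Lemma cond_le_scan (E : set T) (E' : nat -> set T) (f B : nat -> R) (u i : nat) :
  measurable E -> (forall c, measurable (E' c)) ->
  (forall c, (u < c)%N -> E `&` mark (sitenn c i) `<=` E' c) ->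
  (forall c, (u < c)%N -> cond_le (above i) (E' c) (f c)) ->
  (forall c, (u <= c)%N -> B c = p * f c.+1 + (1 - p) * B c.+1) ->
  (1 - p) ^+ k * B (u + k)%N @[k --> \oo] --> 0 ->
  cond_le (after u i) E (B u).
Proof.
move=> mE mE' EE' hE' hB cB.
(* The scan is cut after [k] columns, where the trivial bound [1] replaces [B (c + k)]. Both
   correction terms vanish as [k] grows. *)
have key (k c : nat) : (u <= c)%N ->
    cond_le (after c i) E (B c - (1 - p) ^+ k * B (c + k)%N + (1 - p) ^+ k).
  elim: k c => [|k IH] c uc.
    rewrite expr0 mul1r addn0 subrr add0r; exact: cond_le_one.
  have -> : B c - (1 - p) ^+ k.+1 * B (c + k.+1)%N + (1 - p) ^+ k.+1 =
     p * f c.+1 + (1 - p) * (B c.+1 - (1 - p) ^+ k * B (c.+1 + k)%N + (1 - p) ^+ k).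
    by rewrite hB// exprS addnS addSn; ring.
  apply: (@cond_le_query _ _ (E' c.+1) E _ _ (sitenn c.+1 i)) => //.
  - by exists c.+1, i; split => //; right.
  - by apply: EE'; rewrite ltnS.
  - apply: cond_le_weaken (hE' c.+1 _) => //.
    by apply: subset_trans (@after_next c i); exact: above_after.
  - apply: cond_le_weaken (IH c.+1 _) => //; [exact: after_next|exact: leqW].
move=> C hC.
have hq : 0 <= 1 - p < 1 by case/andP: hp => *; apply/andP; split; lra.
have hc : Pr C * (B u - (1 - p) ^+ k * B (u + k)%N + (1 - p) ^+ k) @[k --> \oo]
    --> Pr C * (B u - 0 + 0).
  apply: cvgMr; apply: cvgD; first by apply: cvgB => //; exact: cvg_cst.
  by apply: cvg_expr; rewrite ger0_norm; lra.
rewrite -[B u]subr0 -[_ - 0]addr0.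
rewrite -(cvg_lim _ hc)//; apply: limr_ge; first by apply/cvg_ex; eexists; exact: hc.
by apply: nearW => k; apply: key.
Qed.

(** * Collecting marks with one skipped row per block *)

Variables (m : int) (n : nat).

(* [k] more marks can be collected in the columns [> c, <= m] and the rows
   [> i, <= n]. *)
Fixpoint coll (w : T) (k c i : nat) : Prop :=
  if k is k'.+1 then
    exists c' i', [/\ (c < c')%N, (i < i' <= n)%N, mark (sitenn c' i') w &
                      coll w k' c' i']
  else c%:Z <= m.

Definition bad (k c i : nat) : set T := [set w | ~ coll w k c i].

Lemma coll_le w k c c' i i' : (c <= c')%N -> (i <= i')%N ->
  coll w k c' i' -> coll w k c i.
Proof.
case: k => [|k] /= cc ii; first lia.
by move=> [d [j [h1 h2 h3 h4]]]; exists d, j; split => //; lia.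
Qed.

Lemma coll_pred w k c i : coll w k.+1 c i -> coll w k c i.
Proof.
elim: k c i => [|k IH] c i /=; first by move=> [d [j [h1 h2 h3 h4]]]; lia.
move=> [d [j [h1 h2 h3 h4]]]; exists d, j; split => //; exact: IH h4.
Qed.

(** The predecessor [k.-1] covers [k = 0] as well, so the walks may go on when no mark is wanted any
    more. *)
Lemma coll_step w k c c' i : (c < c')%N -> (i < n)%N -> mark (sitenn c' i.+1) w ->
  coll w k.-1 c' i.+1 -> coll w k c i.
Proof.
case: k => [|k] cc ii hm h; first by apply: coll_le h; [exact: ltnW|].
by exists c', i.+1; split => //; rewrite ltnSn.
Qed.

Lemma measurable_coll k c i : measurable [set w | coll w k c i].
Proof.
elim: k c i => [|k IH] c i /=.
  case: (c%:Z <= m).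
    by rewrite [X in measurable X](_ : _ = setT)//; apply/seteqP; split.
  by rewrite [X in measurable X](_ : _ = set0)//; apply/seteqP; split.
pose F c' i' : set T := if (c < c')%N && (i < i' <= n)%N then
  mark (sitenn c' i') `&` [set w | coll w k c' i'] else set0.
rewrite [X in measurable X](_ : _ = \bigcup_c' \bigcup_i' F c' i').
  apply: bigcup_measurable => c' _; apply: bigcup_measurable => i' _.
  by rewrite /F; case: ifP => // _; apply: measurableI => //; exact: measurable_mark.
rewrite eqEsubset; split => w /=.
- move=> [c' [i' [h1 h2 h3 h4]]]; exists c' => //; exists i' => //.
  by rewrite /F h1 h2.
- move=> [c' _ [i' _]]; rewrite /F; case: ifP => // /andP[h1 h2] [h3 h4].
  by exists c', i'.
Qed.

Lemma measurable_bad k c i : measurable (bad k c i).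
Proof. exact: measurableC (measurable_coll k c i). Qed.

Lemma bad_le k c c' i i' : (c <= c')%N -> (i <= i')%N -> bad k c i `<=` bad k c' i'.
Proof. by move=> cc ii w /= h1 h2; apply: h1; exact: coll_le h2. Qed.

Lemma bad_step k c c' i : (c < c')%N -> (i < n)%N ->
  bad k c i `&` mark (sitenn c' i.+1) `<=` bad k.-1 c' i.+1.
Proof. by move=> cc ii w [h1 h2] h3; apply: h1; exact: coll_step h3. Qed.

(* [T'] marks remain to be collected in the later blocks. With [r] rows of the
   current block left, [v] has already skipped a row and [u] has not, so the
   block fails only if both [bad (r + T') v] and [bad (r + T').-1 u] occur. [B]
   is the potential between the moves of [v] and of [u] in a row. *)
Lemma cond_le_block (T' N : nat) (Phi B : nat -> nat -> nat -> R) (c i : nat) :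
  (0 < N)%N -> (i + N <= n)%N ->
  (forall v, cond_le (above (i + N)) (bad T' v (i + N)) (Phi 0 v v)) ->
  (forall v u, (v <= u)%N -> Phi 0 v v <= Phi 0 v u) ->
  (forall r v u, (v <= u)%N ->
     B r v u = p * Phi r v u.+1 + (1 - p) * B r v u.+1) ->
  (forall r v u, (v <= u)%N -> (1 - p) ^+ k * B r v (u + k)%N @[k --> \oo] --> 0) ->
  (forall r u, B r u u <= Phi r.+1 u u) ->
  (forall r v u, (v < u)%N ->
     p * B r v.+1 u + (1 - p) * Phi r.+1 v.+1 u <= Phi r.+1 v u) ->
  cond_le (above i) (bad (N.-1 + T') c i) (Phi N c c).
Proof.
move=> N0 iN hend hPhi hB cB hdiag hstep.
pose E r v u j := bad (r + T') v j `&` bad (r + T').-1 u j.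
have mE r v u j : measurable (E r v u j) by apply: measurableI; exact: measurable_bad.
(* Induction on the rows left. At the start both walks sit in [c], and the event for [v] follows
   from the one for [u] by [coll_pred]. *)
suff key r : forall v u j, (j + r = i + N)%N -> (v <= u)%N ->
    cond_le (above j) (E r v u j) (Phi r v u).
  apply: cond_le_weaken (key N c c i _ _) => //; first exact: measurable_bad.
  move=> w hw; split; last by case: N N0 hw {iN hend key}.
  by case: N N0 hw {iN hend key} => // N _ hw h; apply: hw; exact: coll_pred.
elim: r => [|r IH] v u j jr vu.
  rewrite addn0 in jr; rewrite jr.
  apply: cond_le_weaken (hend v) => //; [exact: measurable_bad| |exact: hPhi].
  by rewrite /E add0n => w [].
have jn : (j < n)%N by lia.
(* The state in the middle of row [j.+1]: [v'] has made its move, [u'] has not. *)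
pose E2 v' u' := bad (r + T') v' j.+1 `&` bad (r + T') u' j.
have mE2 v' u' : measurable (E2 v' u') by apply: measurableI; exact: measurable_bad.
have h2 v' u' : (v' <= u')%N -> cond_le (after u' j.+1) (E2 v' u') (B r v' u').
  move=> vu'; apply: (@cond_le_scan (E2 v' u') (fun d => E r v' d j.+1)
    (Phi r v') (B r v')) => //.
  - move=> d ud w [[h h'] hm]; split => //.
    exact: (bad_step ud jn (conj h' hm)).
  - by move=> d ud; apply: IH; [lia|lia].
  - by move=> d ud; apply: hB; lia.
  - exact: cB.
(* The scan of [v], by induction on its distance [l] to [u]. At [l = 0] no mark was found, and [v]
   takes the old [u] one row up: this is the skip. *)
have h1 : forall l v', u = (v' + l)%N ->
    cond_le (after v' j.+1) (E r.+1 v' u j) (Phi r.+1 v' u).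
  elim=> [|l IHl] v' uv.
    rewrite addn0 in uv; rewrite -uv.
    apply: cond_le_weaken (h2 u u _) => // w [_ h]; split => //.
    by apply: bad_le h => //.
  apply: (@cond_le_weaken (after v' j.+1) _ (E r.+1 v' u j) _ _ _ _ _ _ _ (hstep r v' u _)) => //.
    by lia.
  apply: (@cond_le_query _ _ (E2 v'.+1 u) (E r.+1 v'.+1 u j) _ _ (sitenn v'.+1 j.+1)) => //.
  - by exists v'.+1, j.+1; split => //; right.
  - move=> w [[ha hb] hm]; split => //.
    exact: (bad_step (ltnSn v') jn (conj ha hm)).
  - by move=> w [[ha hb] _]; split => //; apply: bad_le ha.
  - apply: cond_le_weaken (h2 v'.+1 u _) => //; last by lia.
    by apply: subset_trans (@after_next v' j.+1); apply: after_le; lia.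
  - by apply: cond_le_weaken (IHl v'.+1 _) => //; [exact: after_next|lia].
apply: cond_le_weaken (h1 (u - v)%N v _) => //; [exact: after_above|lia].
Qed.

(** Induction on the blocks, each of which costs a factor [rho]. After the last one failure means
    [c > m], where [K r ^ (2 c) >= 1] makes the bound trivial. *)
Lemma cond_le_blocks (N : nat) (Phi B : nat -> nat -> nat -> R) (K rho r : R) :
  (0 < N)%N -> 0 <= K -> 0 <= rho ->
  (forall c : nat, m < c%:Z -> 1 <= K * r ^+ (c + c)) ->
  0 <= r ->
  (forall v, Phi 0 v v = r ^+ (v + v)) ->
  (forall c, Phi N c c = rho * r ^+ (c + c)) ->
  (forall v u, (v <= u)%N -> Phi 0 v v <= Phi 0 v u) ->
  (forall k v u, (v <= u)%N ->
     B k v u = p * Phi k v u.+1 + (1 - p) * B k v u.+1) ->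
  (forall k v u, (v <= u)%N -> (1 - p) ^+ j * B k v (u + j)%N @[j --> \oo] --> 0) ->
  (forall k u, B k u u <= Phi k.+1 u u) ->
  (forall k v u, (v < u)%N ->
     p * B k v.+1 u + (1 - p) * Phi k.+1 v.+1 u <= Phi k.+1 v u) ->
  forall b c i, (i + b * N <= n)%N ->
  cond_le (above i) (bad (b * N.-1) c i) (K * rho ^+ b * r ^+ (c + c)).
Proof.
move=> N0 K0 rho0 hK r0 hv hN hPhi hB cB hdiag hstep.
elim=> [|b IH] c i hi.
  rewrite mul0n expr0 mulr1 => C hC.
  have [cm|mc] := boolP (c%:Z <= m).
    have -> : C `&` bad 0 c i = set0 by rewrite -subset0 => w [_]; apply.
    have -> : Pr set0 = 0 by rewrite /Pr measure0.
    rewrite mulr_ge0//.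
    by rewrite mulr_ge0// exprn_ge0.
  apply: le_trans (cond_le_one (measurable_bad 0 c i) hC) _.
  rewrite ler_wpM2l//.
  by rewrite hK// ltNge.
have hi' : (i + N + b * N <= n)%N by move: hi; rewrite mulSn addnA.
rewrite mulSn.
have K1 : 0 <= K * rho ^+ b by rewrite mulr_ge0// exprn_ge0.
have -> : K * rho ^+ b.+1 * r ^+ (c + c) = K * rho ^+ b * Phi N c c.
  by rewrite hN exprS; ring.
apply: (@cond_le_block _ _ (fun k v u => K * rho ^+ b * Phi k v u)
                       (fun k v u => K * rho ^+ b * B k v u)) => //.
- by move: hi'; lia.
- by move=> v; rewrite hv; apply: IH.
- by move=> v u vu; rewrite ler_wpM2l// hPhi.
- by move=> k v u vu; rewrite hB//; ring.
- move=> k v u vu; rewrite -[0](mulr0 (K * rho ^+ b)).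
  under eq_fun do rewrite mulrCA.
  by apply: cvgMr; apply: cB.
- by move=> k u; rewrite ler_wpM2l// hdiag.
- move=> k v u vu; apply: le_trans (ler_wpM2l K1 (hstep k v u vu)).
  by rewrite le_eqVlt; apply/orP; left; apply/eqP; ring.
Qed.

End Exploration.

(** * The tail of the loss *)

Lemma leq_divn_double n d : (0 < d)%N -> (d <= n)%N -> (n <= 2 * (n %/ d) * d)%N.
Proof.
move=> d0 dn; rewrite {1}(divn_eq n d) -mulnA mul2n -addnn leq_add2l.
apply: ltnW; apply: leq_trans (ltn_pmod n d0) _.
by rewrite leq_pmull// divn_gt0.
Qed.

Section Tail.
Context (R : realType) (disp : measure_display) (T : measurableType disp).
Context (P : probability T R) (p : R) (X : site -> {RV P >-> R}).
Hypothesis hp : 0 < p < 1.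
Hypothesis Xbernoulli : forall v, bernoulli_RV p (X v).
Hypothesis Xindep : mutually_independent X.

Lemma coll_collectable (m : int) (n k : nat) w :
  coll X m n w k 0 0 -> collectable (fun v => X v w) m n%:Z k.
Proof.
suff h c i : coll X m n w k c i -> exists s : seq site,
    [/\ size s = k, path lt_both (sitenn c i) s, all (in_rect m n%:Z) s
      & all (marked (fun v => X v w)) s].
  move=> /h [s [sk hs h1 h2]]; exists s; split => //; exact: path_sorted hs.
elim: k c i => [|k IH] c i /=; first by move=> _; exists [::].
move=> [c' [i' [cc ii hm hk]]]; have [s [sk hs h1 h2]] := IH _ _ hk.
have cm : c'%:Z <= m.
  elim: k c' i' hk {IH sk hs hm cc ii} => //= k IH c' i' [d [j [h3 _ _ h4]]].
  by have := IH _ _ h4; lia.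
exists (sitenn c' i' :: s); split => /=; first by rewrite sk.
- by rewrite hs andbT /lt_both /sitenn /=; lia.
- by rewrite h1 andbT /in_rect /sitenn /=; lia.
- by rewrite h2 andbT /marked; apply/eqP.
Qed.

(** * Measurability *)

Lemma measurable_collectable (m n : int) k :
  measurable [set w | collectable (fun v => X v w) m n k].
Proof.
(* Paths are finite sequences of sites, hence countable; [j] runs over their codes. *)
pose F (j : nat) : set T := if @choice.unpickle (seq site) j is Some s then
  (if [&& size s == k, sorted lt_both s & all (in_rect m n) s] then
    \bigcap_(v in [set` s]) mark X v else set0) else set0.
rewrite [X in measurable X](_ : _ = \bigcup_j F j).
  apply: bigcup_measurable => j _; rewrite /F.
  case: choice.unpickle => // s; case: ifP => // _.
  apply: fin_bigcap_measurable => // v _; exact: measurable_mark.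
rewrite eqEsubset; split => w /=.
- move=> [s [sk s1 s2 s3]]; exists (choice.pickle s) => //.
  rewrite /F choice.pickleK sk eqxx s1 s2 /= => v vs.
  by apply/eqP; exact: (allP s3 v vs).
- move=> [j _]; rewrite /F; case: choice.unpickle => // s.
  case: ifP => // /and3P[/eqP sk s1 s2] h; exists s; split => //.
  by apply/allP => v vs; apply/eqP; exact: h.
Qed.

Lemma measurable_L (m n : int) (Q : set nat) :
  measurable [set w | Q (L (fun v => X v w) m n)].
Proof.
pose G k := [set w | (k <= L (fun v => X v w) m n)%N].
have mG k : measurable (G k).
  rewrite [X in measurable X](_ : _ = \bigcup_(j in [set j | (k <= j)%N])
     [set w | collectable (fun v => X v w) m n j]).
    by apply: bigcup_measurable => j _; exact: measurable_collectable.
  rewrite eqEsubset; split => w /=.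
  - by move=> h; exists (L (fun v => X v w) m n) => //; exact: L_collectable.
  - by move=> [j /= kj /collectable_leq_L]; exact: leq_trans.
rewrite [X in measurable X](_ : _ = \bigcup_(k in Q) (G k `\` G k.+1)).
  by apply: bigcup_measurable => k _; exact: measurableD.
rewrite eqEsubset; split => w /=.
- by move=> h; exists (L (fun v => X v w) m n) => //; split; rewrite /G /= ?ltnn.
- move=> [k Qk [/= h1 h2]].
  have -> // : L (fun v => X v w) m n = k.
  by apply/eqP; rewrite eqn_leq h1 andbT leqNgt; apply/negP.
Qed.

Variables (x a : R).
Hypothesis (hx : 0 < x).
Hypothesis (ha : 0 < a <= 1 / 2).

Definition ncols (n : nat) : int := Num.floor (p^-1 * n%:R - x * n%:R `^ a).

Definition loss (n : nat) (w : T) : R :=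
  n%:R - (L (fun v => X v w) (ncols n) n%:Z)%:R.

Lemma loss_ge0 n w : 0 <= loss n w.
Proof.
rewrite subr_ge0 ler_nat.
by have := collectable_leq (L_collectable (fun v => X v w) (ncols n) n%:Z).
Qed.

Lemma measurable_loss n (Q : set R) : measurable [set w | Q (loss n w)].
Proof. exact: (measurable_L (ncols n) n%:Z [set k | Q (n%:R - k%:R)]). Qed.

(** As [a <= 1 / 2] and [n >= 1], the deficit [x n ^ a] is largest at [a = 1 / 2]; the final [1]
    pays for the floor. *)
Lemma ncols_ge n : (0 < n)%N ->
  n%:R / p - x * Num.sqrt n%:R - 1 <= (ncols n)%:~R.
Proof.
move=> n0; have := floorD1_gt (p^-1 * n%:R - x * n%:R `^ a).
rewrite -/(ncols n) intrD.
have : x * n%:R `^ a <= x * Num.sqrt n%:R.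
  rewrite ler_pM2l// -powR12_sqrt//; apply: ler_powR; first by rewrite ler1n.
  by rewrite -div1r; case/andP: ha.
lra.
Qed.

(** If every block of [N = n / B] rows yields [N - 1] marks, the loss is at most
    [B + n mod B < 2 B]. *)
Lemma loss_bad n B : (0 < B)%N ->
  [set w | B%:R * 2 < loss n w] `<=` bad X (ncols n) n (B * (n %/ B).-1) 0 0.
Proof.
move=> B0 w /= h /coll_collectable /collectable_leq_L hL.
have {h} : (B * 2 + L (fun v => X v w) (ncols n) n%:Z < n)%N.
  by move: h; rewrite /loss -(ltr_nat R) natrD natrM; lra.
have := divn_eq n B; have := ltn_pmod n B0; move: hL.
case: (n %/ B)%N => [|N] /=; nia.
Qed.

Lemma loss_tail : exists C ka : R, exists N0 : nat, [/\ 0 < C, 0 < ka &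
  forall n B, (0 < B)%N -> (N0 * B <= n)%N ->
  (P [set w | (B%:R * 2 < loss n w)%R] <= (C * expR (- (ka * B%:R)))%:E)%E].
Proof.
have [tau [ka [s0 [tau0 ka0 s00 hpar]]]] := potential_params hp.
case/andP: (hp) => p0 p1.
(* The first constant and the lost half of [ka] come from the weighted square in [h4]; the last
   value forces [N >= tau / s0 ^ 2], that is [s <= s0]. *)
exists (expR ((x + 1) ^+ 2 * 4 * tau / ka)), (ka / 2), (Num.truncn (tau / s0 ^+ 2)).+1.
split; [exact: expR_gt0|by rewrite divr_gt0|move=> n B B0 hn].
pose N := (n %/ B)%N.
have hN : ((Num.truncn (tau / s0 ^+ 2)).+1 <= N)%N by rewrite leq_divRL.
have N0 : (0 < N)%N by apply: leq_trans hN.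
have NR0 : 0 < N%:R :> R by rewrite ltr0n.
pose s := Num.sqrt (tau / N%:R).
have hs : N%:R * s ^+ 2 = tau.
  by rewrite sqr_sqrtr ?divr_ge0 ?(ltW tau0)// mulrC divfK// gt_eqF.
have s_ge0 : 0 <= s by exact: sqrtr_ge0.
have s_le : 0 <= s <= s0.
  rewrite s_ge0 /= -ler_sqr ?nnegrE ?(ltW s00)// sqr_sqrtr ?divr_ge0 ?(ltW tau0)//.
  rewrite ler_pdivrMr// mulrC -ler_pdivrMr ?exprn_gt0//.
  have := truncn_itv (divr_ge0 (ltW tau0) (sqr_ge0 s0)) => /andP[_ /ltW h].
  by apply: le_trans h _; rewrite ler_nat.
clearbody s.
have [kap [be [hbe hqr hterm hrho]]] := hpar N s N0 s_le hs.
set r := expR s in hqr hterm hrho.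
have r1 : 1 <= r by rewrite -expR0 ler_expR.
set rho := (1 - be) * _ + _ in hrho.
have rho0 : 0 <= rho.
  case/andP: hbe => b0 b1.
  apply: addr_ge0; apply: mulr_ge0 => //.
  - by lra.
  - by rewrite exprn_ge0// sqr_ge0.
  - by rewrite exprn_ge0// pot1_ge0.
pose m := ncols n.
(* Normalised so that [K r ^ (2 c) = exp (2 s (c - m))]. *)
pose K := expR (- (2 * s * m%:~R)).
have BN : (B * N <= n)%N by rewrite mulnC; exact: leq_trunc_div.
have hbnd : cond_le X (above 0) (bad X m n (B * N.-1) 0 0) (K * rho ^+ B * r ^+ (0 + 0)).
  apply: (@cond_le_blocks _ _ _ _ _ _ hp Xbernoulli m n N
    (potential p r kap be) (half_potential p r kap be)) => //.
  - exact: expR_ge0.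
  - move=> c mc; rewrite /K /r -expRM_natr -expRD -[leLHS]expR0 ler_expR natrD.
    have : m%:~R <= c%:R :> R by rewrite -(ltr_int R) in mc; exact: ltW mc.
    by rewrite -subr_ge0 => h; have := mulr_ge0 s_ge0 h; lra.
  - by apply: expR_ge0.
  - by move=> v; rewrite /potential !expr0 subnn mulr0 cos0 !mulr1 subrK mulr1.
  - by move=> c; rewrite /potential subnn mulr0 cos0 mulr1 mulrC.
  - by move=> v u vu; apply: potential_end.
  - by move=> k v u vu; apply: half_potential_rec.
  - by move=> k v u vu; apply: half_potential_cvg.
  - by move=> k u; apply: half_potential_diag.
  - by move=> k v u vu; apply: potential_step.
have := hbnd setT (indep_of_setT Xindep _).
rewrite setTI probability_setT mul1r addn0 expr0 mulr1 => {}hbnd.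
apply: (@le_trans _ _ (P (bad X m n (B * N.-1) 0 0))).
  apply: le_measure; rewrite ?inE.
  - exact: (measurable_loss n [set y | _ < y]).
  - exact: measurable_bad.
  - exact: loss_bad.
rewrite -[P _]fineK ?fin_num_measure//; last exact: measurable_bad.
rewrite lee_fin; apply: le_trans hbnd _.
have : rho ^+ B <= expR (2 * s * N%:R / p - ka) ^+ B by rewrite lerXn2r ?nnegrE ?expR_ge0.
rewrite -expRM_natr => h.
apply: le_trans (ler_wpM2l (expR_ge0 _) h) _.
rewrite /K -!expRD ler_expR.
have n0 : (0 < n)%N by apply: leq_trans BN; rewrite muln_gt0 B0.
have hm := ncols_ge n0; rewrite -/m in hm.
(* The drift [2 s N B / p] is cancelled by [K] up to [2 s (x sqrt n + 1) <= 2 (x + 1) y], and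
   [y ^ 2] is only of order [B]. *)
pose y := s * Num.sqrt n%:R.
have n1 : 1 <= Num.sqrt n%:R :> R by rewrite -{1}sqrtr1 ler_sqrt ?ltr0n// ler1n.
have y0 : 0 <= y by rewrite mulr_ge0// sqrtr_ge0.
have sy : s <= y by rewrite ler_peMr.
have hy : y ^+ 2 <= 2 * tau * B%:R.
  rewrite exprMn sqr_sqrtr// -hs.
  have : n%:R <= 2 * N%:R * B%:R :> R.
    by rewrite -!natrM ler_nat; apply: leq_divn_double => //;
      apply: leq_trans BN; rewrite leq_pmulr.
  have -> : 2 * (N%:R * s ^+ 2) * B%:R = s ^+ 2 * (2 * N%:R * B%:R) by ring.
  exact: ler_wpM2l (sqr_ge0 s) _ _.
have BNR : B%:R * N%:R <= n%:R :> R by rewrite -natrM ler_nat.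
have h1 : 2 * s * N%:R / p * B%:R <= 2 * s * (n%:R / p).
  rewrite -!mulrA ler_pM2l// ler_wpM2l// mulrCA mulrC ler_pM2r ?invr_gt0//.
  by rewrite mulrC.
have h2 : - (2 * s * m%:~R) <= 2 * s * (- (n%:R / p) + x * Num.sqrt n%:R + 1).
  by rewrite -mulrN ler_wpM2l ?mulr_ge0//; lra.
have h3 : 2 * s * (x * Num.sqrt n%:R) = 2 * x * y by rewrite /y; ring.
(* The weight [ka / (4 tau)] turns [y ^ 2 <= 2 tau B] into exactly half of the decay [ka B]. *)
have h4 : 2 * (x + 1) * y <= (x + 1) ^+ 2 * 4 * tau / ka + ka / (4 * tau) * y ^+ 2.
  pose g := ka / (4 * tau).
  have g0 : 0 < g by rewrite divr_gt0// mulr_gt0.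
  have -> : (x + 1) ^+ 2 * 4 * tau / ka = (x + 1) ^+ 2 / g.
    by rewrite /g; field; rewrite !gt_eqF.
  rewrite -subr_ge0 -/g.
  have -> : (x + 1) ^+ 2 / g + g * y ^+ 2 - 2 * (x + 1) * y = (x + 1 - g * y) ^+ 2 / g.
    by field; rewrite gt_eqF.
  by rewrite divr_ge0 ?sqr_ge0 ?ltW.
have h5 : ka / (4 * tau) * y ^+ 2 <= ka / 2 * B%:R.
  have -> : ka / 2 * B%:R = ka / (4 * tau) * (2 * tau * B%:R) by field; rewrite gt_eqF.
  by rewrite ler_wpM2l// divr_ge0 ?(ltW ka0)// mulr_ge0 ?(ltW tau0).
lra.
Qed.

(** * From the tail to both modes of convergence *)

Lemma loss_ratio_tail (eps : R) : 0 < eps -> exists C ka : R, [/\ 0 < C, 0 < ka &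
  forall d : nat -> R, (forall n, (1 <= n)%N -> 0 < d n) ->
    d n @[n --> \oo] --> +oo -> d =o_\oo (fun n => n%:R : R) ->
    \forall n \near \oo,
      (P [set w | (eps < `|loss n w / d n - 0|)%R] <= (C * expR (- (ka * d n)))%:E)%E].
Proof.
move=> eps0; have [C [ka [N0 [C0 ka0 htail]]]] := loss_tail.
(* The factor [expR ka] pays for rounding [eps d / 2] down to [B]. *)
exists (C * expR ka), (ka * eps / 2); split.
- by rewrite mulr_gt0// expR_gt0.
- by rewrite divr_gt0// mulr_gt0.
move=> d d0 /cvgryPge dy /eqoP od.
have c0 : 0 < 2 / (eps * N0.+1%:R) by rewrite divr_gt0// mulr_gt0.
near=> n.
have n1 : (1 <= n)%N by near: n; exact: nbhs_infty_ge.
have dn := d0 n n1.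
have d2 : 2 / eps <= d n by near: n; exact: dy.
have dle : d n <= 2 / (eps * N0.+1%:R) * n%:R.
  have : `|d n| <= 2 / (eps * N0.+1%:R) * `|n%:R : R| by near: n; exact: od.
  by rewrite ger0_norm ?(ltW dn)// ger0_norm.
(* The largest [B] with [2 B <= eps d n]. It is positive because [d] diverges, and [N0 B <= n]
   because [d = o(n)]. *)
pose B := Num.truncn (eps * d n / 2).
have ed0 : 0 <= eps * d n / 2 by rewrite divr_ge0// mulr_ge0 ?(ltW eps0) ?(ltW dn).
have /andP[B1 B2] := truncn_itv ed0; rewrite -/B in B1 B2.
have B0 : (0 < B)%N.
  by rewrite truncn_gt0 ler_pdivlMr// mul1r mulrC -ler_pdivrMr.
clearbody B.
have hB : (N0 * B <= n)%N.
  rewrite -(ler_nat R) natrM.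
  have h : eps * d n / 2 * N0.+1%:R <= n%:R.
    have := ler_wpM2l (ltW (mulr_gt0 eps0 (ltr0Sn R N0))) dle.
    have -> : eps * N0.+1%:R * (2 / (eps * N0.+1%:R) * n%:R) = 2 * n%:R.
      by field; rewrite gt_eqF//= gt_eqF// ltr0Sn.
    lra.
  apply: le_trans h; rewrite mulrC; apply: ler_pM => //.
  by rewrite ler_nat.
apply: (@le_trans _ _ (P [set w | B%:R * 2 < loss n w])).
  apply: le_measure; rewrite ?inE.
  - exact: (measurable_loss n [set y | eps < `|y / d n - 0|]).
  - exact: (measurable_loss n [set y | B%:R * 2 < y]).
  - move=> w /=; rewrite subr0 ger0_norm ?divr_ge0 ?loss_ge0 ?(ltW dn)//.
    by rewrite ltr_pdivlMr//; apply: le_lt_trans; lra.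
apply: le_trans (htail n B B0 hB) _.
rewrite lee_fin -mulrA ler_pM2l// -expRD ler_expR.
rewrite -[B.+1%:R]natr1 in B2.
have := ler_wpM2l (ltW ka0) (ltW B2); lra.
Unshelve. all: by end_near. Qed.

Lemma loss_cvg_in_probability (d : nat -> R) :
  (forall n, (1 <= n)%N -> 0 < d n) ->
  d n @[n --> \oo] --> +oo -> d =o_\oo (fun n => n%:R : R) ->
  cvg_in_probability P (fun n w => loss n w / d n) (fun=> 0).
Proof.
move=> d0 dy od eps eps0.
have [C [ka [C0 ka0 /(_ d d0 dy od) h]]] := loss_ratio_tail eps0.
apply: (@squeeze_cvge _ _ _ _ (cst 0%E) _ (fun n => (C * expR (- (ka * d n)))%:E)).
- by near=> n; rewrite measure_ge0 /=; near: n.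
- exact: cvg_cst.
- apply: cvg_EFin; first exact: nearW.
  rewrite /= -[0](mulr0 C); apply: cvgMr.
  apply: (cvg_comp (fun n => ka * d n) (fun y => expR (- y))); last exact: cvgr_expR.
  move/cvgryPge in dy; apply/cvgryPge => A; near=> n.
  by rewrite mulrC -ler_pdivrMr//; near: n; exact: dy.
Unshelve. all: by end_near. Qed.

(** Telescoping: [1 / y ^ 2 <= 2 (1 / y - 1 / (y + 1))] for [y >= 1]. *)
Lemma summable_inv_sqr_bound (u : nat -> \bar R) (C : R) : 0 <= C ->
  (forall n, 0 <= u n)%E -> u 0%N = 0%E ->
  (forall n, (0 < n)%N -> (u n <= (C / n%:R ^+ 2)%:E)%E) ->
  (\sum_(0 <= n <oo) u n < +oo)%E.
Proof.
move=> C0 u0 uz uC.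
apply: (@le_lt_trans _ _ (2 * C)%:E); last exact: ltry.
apply: lime_le; first by apply: is_cvg_nneseries => *.
apply: nearW => k.
have key j : (\sum_(0 <= i < j.+1) u i <= (2 * C * (1 - j.+1%:R^-1))%:E)%E.
  elim: j => [|j IH]; first by rewrite big_nat1 uz invr1 subrr mulr0.
  rewrite big_nat_recr//=; apply: le_trans (leeD IH (uC j.+1 _)) _ => //.
  rewrite -EFinD lee_fin -[j.+2%:R]natr1.
  set y := j.+1%:R; have y1 : 1 <= y by rewrite ler1n.
  have y0 : 0 < y by lra.
  rewrite -subr_ge0.
  have -> : 2 * C * (1 - (y + 1)^-1) - (2 * C * (1 - y^-1) + C / y ^+ 2) =
    C * (y - 1) / (y ^+ 2 * (y + 1)).
    by field; rewrite !gt_eqF//; lra.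
  rewrite divr_ge0// ?mulr_ge0 ?sqr_ge0//; lra.
case: k => [|k]; first by rewrite big_geq// lee_fin mulr_ge0.
by apply: le_trans (key k) _; rewrite lee_fin ler_piMr ?mulr_ge0.
Qed.

Lemma borel_cantelli_near (E : nat -> set T) (C : R) : 0 <= C ->
  (forall n, measurable (E n)) ->
  (\forall n \near \oo, (P (E n) <= (C / n%:R ^+ 2)%:E)%E) ->
  {ae P, forall w, \forall n \near \oo, ~ E n w}.
Proof.
move=> C0 mE [M _ hM].
(* Emptying finitely many events does not affect the upper limit and makes the bound hold for every
   [n > 0]. *)
pose F n := if (maxn 1 M <= n)%N then E n else set0.
have mF n : measurable (F n) by rewrite /F; case: ifP.
exists (lim_sup_set F); split.
- apply: bigcap_measurable => // k _.
  by apply: bigcup_measurable => j _.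
- apply: lim_sup_set_cvg0 => //.
  apply: (@summable_inv_sqr_bound _ C) => //.
  + by rewrite /F; case: ifP => [|_]; [lia|rewrite measure0].
  + move=> n n0; rewrite /F; case: ifP => [h|_]; first by apply: hM => /=; lia.
    by rewrite measure0 lee_fin divr_ge0 ?sqr_ge0.
- move=> w /= hw k _; apply: contrapT => hk; apply: hw.
  exists (maxn k (maxn 1 M)) => // n /= hn hE; apply: hk.
  by exists n => /=; [lia|rewrite /F; have -> : (maxn 1 M <= n)%N by lia].
Qed.

Lemma loss_cvg_almost_surely (d : nat -> R) :
  (forall n, (1 <= n)%N -> 0 < d n) ->
  d =o_\oo (fun n => n%:R : R) ->
  d n / ln n%:R @[n --> \oo] --> +oo ->
  cvg_almost_surely P (fun n w => loss n w / d n) (fun=> 0).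
Proof.
move=> d0 od /cvgryPge dl.
have dln (A : R) : 0 <= A -> \forall n \near \oo, A * ln n%:R <= d n.
  move=> A0; near=> n.
  have n2 : (1 < n)%N by near: n; exact: nbhs_infty_ge.
  rewrite -ler_pdivlMr ?ln_gt0 ?ltr1n//.
  by near: n; exact: dl.
have dy : d n @[n --> \oo] --> +oo.
  apply/cvgryPge => A; near=> n.
  have h : 1 * ln n%:R <= d n by near: n; exact: dln.
  apply: le_trans h; rewrite mul1r.
  have hn : expR A <= n%:R by near: n; exact: nbhs_infty_ger.
  by rewrite -[A]expRK ler_ln ?posrE ?expR_gt0// (lt_le_trans _ hn)// expR_gt0.
(* Countably many thresholds [1 / (k + 1)] suffice, so the exceptional null sets can be united. *)
have key (k : nat) : {ae P, forall w, \forall n \near \oo,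
    ~ (k.+1%:R^-1 < `|loss n w / d n - 0|)}.
  have e0 : 0 < k.+1%:R^-1 :> R by rewrite invr_gt0.
  have [C [ka [C0 ka0 /(_ d d0 dy od) h]]] := loss_ratio_tail e0.
  apply: (@borel_cantelli_near (fun n => [set w | k.+1%:R^-1 < `|loss n w / d n - 0|]) C).
  - exact: ltW.
  - by move=> n; exact: (measurable_loss n [set y | k.+1%:R^-1 < `|y / d n - 0|]).
  near=> n.
  have n1 : (0 < n)%N by near: n; exact: nbhs_infty_gt.
  apply: (@le_trans _ _ (C * expR (- (ka * d n)))%:E); first by near: n.
  rewrite lee_fin ler_pM2l//.
  have hn : 0 < n%:R :> R by rewrite ltr0n.
  have -> : (n%:R ^+ 2)^-1 = expR (- (2 * ln n%:R)) :> R.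
    by rewrite expRN mulrC expRM_natr lnK.
  (* The multiple [2 / ka] of the logarithm turns the tail into [n ^ (-2)]. *)
  have h2 : 2 / ka * ln n%:R <= d n by near: n; apply: dln; rewrite divr_ge0// ltW.
  by rewrite ler_expR lerN2 -ler_pdivrMl// mulrCA mulrA.
have : {ae P, forall w, forall k : nat, \forall n \near \oo,
    ~ (k.+1%:R^-1 < `|loss n w / d n - 0|)}.
  rewrite /prop_near1 /nbhs /= /almost_everywhere.
  apply: negligibleS (negligible_bigcup key) => w /= hw.
  apply: contrapT => hU; apply: hw => k; apply: contrapT => hk; apply: hU.
  by exists k.
apply: filterS => w hw.
apply/cvgrPdist_le => eps eps0.
have [k hk] : exists k : nat, k.+1%:R^-1 <= eps.
  exists (Num.truncn eps^-1); rewrite invf_ple ?posrE//.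
  have := truncn_itv (ltW (_ : 0 < eps^-1)); rewrite invr_gt0 => /(_ eps0) /andP[_].
  exact: ltW.
near=> n.
apply: le_trans hk; rewrite distrC leNgt; apply/negP.
by near: n; exact: hw.
Unshelve. all: by end_near. Qed.

End Tail.

Theorem theorem2p1 (R : realType) (disp : measure_display)
    (T : measurableType disp) (P : probability T R)
    (p : R) (X : site -> {RV P >-> R}) (x a : R)
    (hp : 0 < p < 1)
    (Xbernoulli : forall v, bernoulli_RV p (X v))
    (Xindep : mutually_independent X)
    (hx : 0 < x) (ha : 0 < a <= 1 / 2) :
  let loss (n : nat) (w : T) : R :=
    n%:R - (L (fun v => X v w)
              (Num.floor (p^-1 * n%:R - x * n%:R `^ a)) n%:Z)%:R in
  (forall d : nat -> R,
     (forall n, (1 <= n)%N -> 0 < d n) ->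
     d n @[n --> \oo] --> +oo ->
     d =o_\oo (fun n => n%:R : R) ->
     cvg_in_probability P (fun n w => loss n w / d n) (fun=> 0))
  /\
  (forall d : nat -> R,
     (forall n, (1 <= n)%N -> 0 < d n) ->
     d =o_\oo (fun n => n%:R : R) ->
     d n / ln n%:R @[n --> \oo] --> +oo ->
     cvg_almost_surely P (fun n w => loss n w / d n) (fun=> 0)).
Proof.
split=> d.
- exact: (loss_cvg_in_probability hp Xbernoulli Xindep hx ha).
- exact: (loss_cvg_almost_surely hp Xbernoulli Xindep hx ha).
Qed.
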